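(* Suppose a split exact sequence of Waldhausen categories and exact functors $$\mathcal{A}\xrightarrow{\ i\ }\mathcal{E}\xrightarrow{\ f\ }\mathcal{B},\qquad \mathcal{A}\xleftarrow{\ j\ }\mathcal{E}\xleftarrow{\ g\ }\mathcal{B}$$ (with $i\dashv j$ and $f\dashv g$) has the following three properties. (i) Each counit component $ij(E)\to E$ is a cofibration. (ii) For each cofibration $E\rightarrowtail E'$ in $\mathcal{E}$, the induced map $E\cup_{ij(E)}ij(E')\to E'$ is a cofibration in $\mathcal{E}$. (iii) In every cofiber sequence in $\mathcal{A}$ of the form $A_0\rightarrowtail A_1\twoheadrightarrow\ast$, the first map is an isomorphism. Then it is Waldhausen equivalent to a standard split exact sequence, i.e. to a split exact sequence of the form $$\mathcal{A}'\to\mathcal{E}(\mathcal{A}',\mathcal{C},\mathcal{B}')\xrightarrow{\ q\ }\mathcal{B}'$$ for some Waldhausen category $\mathcal{C}$ with sub Waldhausen categories $\mathcal{A}'$ and $\mathcal{B}'$.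
   Context: A Waldhausen category is a category $\mathcal{C}$ with a distinguished zero object $\ast$, a subcategory $co\mathcal{C}$ of cofibrations (written $\rightarrowtail$) and a subcategory $w\mathcal{C}$ of weak equivalences such that: every isomorphism is both a cofibration and a weak equivalence; for each object $A$ the unique map $\ast\to A$ is a cofibration; the pushout of a cofibration along any morphism exists and is again a cofibration; and the gluing lemma holds: for any map of diagrams from $(C\leftarrowtail A\to B)$ to $(C'\leftarrowtail A'\to B')$ whose three components are weak equivalences, the induced map $C\cup_AB\to C'\cup_{A'}B'$ is a weak equivalence. A functor between Waldhausen categories is exact if it takes the distinguished zero object to the distinguished zero object, preserves cofibrations and weak equivalences, and sends each pushout along a cofibration to a pushout along a cofibration. A sub Waldhausen category $\mathcal{B}$ of $\mathcal{C}$ is a subcategory that is a Waldhausen category in its own right such that: (i) its distinguished zero object equals that of $\mathcal{C}$; (ii) a morphism of $\mathcal{B}$ is a cofibration in $\mathcal{B}$ if and only if it is a cofibration in $\mathcal{C}$ and its quotient in $\mathcal{C}$ is isomorphic to an object of $\mathcal{B}$; (iii) every pushout square in $\mathcal{B}$ with one leg a $\mathcal{B}$-cofibration is also a pushout square in $\mathcal{C}$; (iv) a morphism of $\mathcal{B}$ is a weak equivalence in $\mathcal{B}$ if and only if it is one in $\mathcal{C}$. A sequence of exact functors $\mathcal{A}\xrightarrow{i}\mathcal{E}\xrightarrow{f}\mathcal{B}$ of Waldhausen categories is exact if: $f\circ i$ is (constant at) the distinguished zero object of $\mathcal{B}$; $i$ is fully faithful; and the restriction $f|_{\mathcal{E}/\mathcal{A}}\colon\mathcal{E}/\mathcal{A}\to\mathcal{B}$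 is an equivalence of categories, where $\mathcal{E}/\mathcal{A}$ is the full subcategory of $\mathcal{E}$ on those $E$ such that $\mathcal{E}(i(A),E)$ is a point for all $A\in\mathcal{A}$. It is split if there are exact functors $j\colon\mathcal{E}\to\mathcal{A}$ and $g\colon\mathcal{B}\to\mathcal{E}$ right adjoint to $i$ and $f$ respectively such that the unit $\mathrm{Id}_{\mathcal{A}}\to ji$ and the counit $fg\to\mathrm{Id}_{\mathcal{B}}$ are natural isomorphisms. A cofiber sequence $A\rightarrowtail C\twoheadrightarrow B$ is a composable pair whose first map is a cofibration and for which the square with corners $A,C,\ast,B$ is a pushout. For sub Waldhausen categories $\mathcal{A},\mathcal{B}$ of $\mathcal{C}$, $\mathcal{E}(\mathcal{A},\mathcal{C},\mathcal{B})$ is the category of cofiber sequences $A\rightarrowtail C\twoheadrightarrow B$ in $\mathcal{C}$ with $A\in\mathcal{A}$, $B\in\mathcal{B}$, a morphism consisting of three morphisms in $\mathcal{A}$, $\mathcal{C}$, $\mathcal{B}$ making the two squares commute. It is a Waldhausen category with levelwise weak equivalences, where a morphism from $A_1\rightarrowtail C_1\twoheadrightarrow B_1$ to $A_2\rightarrowtail C_2\twoheadrightarrow B_2$ is a cofibration if $A_1\to A_2$ is a cofibration in $\mathcal{A}$ and $C_1\cup_{A_1}A_2\to C_2$ is a cofibration in $\mathcal{C}$. The standard split exact sequence associated to $\mathcal{A},\mathcal{B}\subseteq\mathcal{C}$ is $\mathcal{A}\xrightarrow{i}\mathcal{E}(\mathcal{A},\mathcal{C},\mathcal{B})\xrightarrow{q}\mathcal{B}$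 with splitting $(s,g)$, where $i(A)=(A=A\twoheadrightarrow\ast)$, $s(A\rightarrowtail C\twoheadrightarrow B)=A$, $q(A\rightarrowtail C\twoheadrightarrow B)=B$, $g(B)=(\ast\rightarrowtail B=B)$. A Waldhausen equivalence of Waldhausen categories is an exact functor $F\colon\mathcal{C}\to\mathcal{D}$ for which there is an exact functor $G\colon\mathcal{D}\to\mathcal{C}$ with $GF$ and $FG$ naturally isomorphic to the identities. A Waldhausen equivalence of (split exact) sequences from $\mathcal{A}\xrightarrow{i}\mathcal{E}\xrightarrow{f}\mathcal{B}$ to $\mathcal{A}'\xrightarrow{i'}\mathcal{E}'\xrightarrow{f'}\mathcal{B}'$ consists of Waldhausen equivalences $\Phi_{\mathcal{A}},\Phi_{\mathcal{E}},\Phi_{\mathcal{B}}$ between the respective terms together with natural isomorphisms $\Phi_{\mathcal{E}}i\cong i'\Phi_{\mathcal{A}}$ and $\Phi_{\mathcal{B}}f\cong f'\Phi_{\mathcal{E}}$. *)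

(* Defs.v *)
From Stdlib Require Import ProofIrrelevance.

Set Implicit Arguments.
Unset Strict Implicit.
Unset Printing Implicit Defensive.

Record Category := {
  Ob :> Type;
  Hom : Ob -> Ob -> Type;
  id : forall x, Hom x x;
  comp : forall x y z, Hom y z -> Hom x y -> Hom x z;
  comp_id_l : forall x y (u : Hom x y), comp (id y) u = u;
  comp_id_r : forall x y (u : Hom x y), comp u (id x) = u;
  comp_assoc : forall x y z t (w : Hom z t) (v : Hom y z) (u : Hom x y),
    comp w (comp v u) = comp (comp w v) u
}.

Arguments Hom {_} _ _.
Arguments id {_} _.
Arguments comp {_ _ _ _} _ _.

Notation "v ∘ u" := (comp v u) (at level 40, left associativity).

Definition IsIso (C : Category) (x y : C) (u : Hom x y) : Prop :=
  exists v : Hom y x, v ∘ u = id x /\ u ∘ v = id y.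

Definition Isomorphic (C : Category) (x y : C) : Prop :=
  exists u : Hom x y, IsIso u.

(** The square
<<
      x --u--> y
      |        |
      v        p
      |        |
      z --q--> w
>> *)
Definition IsPushout (C : Category) (x y z w : C)
    (u : Hom x y) (v : Hom x z) (p : Hom y w) (q : Hom z w) : Prop :=
  p ∘ u = q ∘ v /\
  forall (t : C) (a : Hom y t) (b : Hom z t), a ∘ u = b ∘ v ->
    exists! h : Hom w t, h ∘ p = a /\ h ∘ q = b.

Record Functor (C D : Category) := {
  fob :> C -> D;
  fmap : forall x y, Hom x y -> Hom (fob x) (fob y);
  fmap_id : forall x, fmap (id x) = id (fob x);
  fmap_comp : forall x y z (v : Hom y z) (u : Hom x y),
    fmap (v ∘ u) = fmap v ∘ fmap u
}.

Arguments fmap {_ _} _ {_ _} _.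

Definition IdFunctor (C : Category) : Functor C C.
Proof.
refine {| fob := fun x => x; fmap := fun _ _ u => u |}; reflexivity.
Defined.

Definition CompFunctor (C D E : Category) (G : Functor D E) (F : Functor C D) :
  Functor C E.
Proof.
refine {| fob := fun x => G (F x); fmap := fun _ _ u => fmap G (fmap F u) |}.
- intros x; rewrite fmap_id; apply fmap_id.
- intros x y z v u; rewrite fmap_comp; apply fmap_comp.
Defined.

Notation "G ∘F F" := (CompFunctor G F) (at level 40, left associativity).

Record NatTrans (C D : Category) (F G : Functor C D) := {
  component :> forall x, Hom (F x) (G x);
  naturality : forall x y (u : Hom x y),
    component y ∘ fmap F u = fmap G u ∘ component x
}.

Definition IsNatIso (C D : Category) (F G : Functor C D) (t : NatTrans F G) :
  Prop := forall x, IsIso (t x).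

Definition NatIsomorphic (C D : Category) (F G : Functor C D) : Prop :=
  exists t : NatTrans F G, IsNatIso t.

Definition FullyFaithful (C D : Category) (F : Functor C D) : Prop :=
  forall (x y : C) (v : Hom (F x) (F y)), exists! u : Hom x y, fmap F u = v.

Definition IsEquivalence (C D : Category) (F : Functor C D) : Prop :=
  exists G : Functor D C,
    NatIsomorphic (G ∘F F) (IdFunctor C) /\ NatIsomorphic (F ∘F G) (IdFunctor D).

Record Adjunction (C D : Category) (L : Functor C D) (R : Functor D C) := {
  adj_unit : NatTrans (IdFunctor C) (R ∘F L);
  adj_counit : NatTrans (L ∘F R) (IdFunctor D);
  triangle_l : forall x : C, adj_counit (L x) ∘ fmap L (adj_unit x) = id (L x);
  triangle_r : forall y : D, fmap R (adj_counit y) ∘ adj_unit (R y) = id (R y)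
}.

(** Neither full nor closed under isomorphism in general. *)
Record Subcategory (C : Category) := {
  in_ob : C -> Prop;
  in_hom : forall x y : C, Hom x y -> Prop;
  in_hom_id : forall x, in_ob x -> in_hom (id x);
  in_hom_comp : forall x y z (v : Hom y z) (u : Hom x y),
    in_hom v -> in_hom u -> in_hom (v ∘ u)
}.

Lemma sig_eq (T : Type) (P : T -> Prop) (u v : sig P) :
  proj1_sig u = proj1_sig v -> u = v.
Proof.
destruct u as [u hu], v as [v hv]; simpl; intros e; subst v.
f_equal; apply proof_irrelevance.
Qed.

Definition SubCat (C : Category) (S : Subcategory C) : Category.
Proof.
refine {|
  Ob := {x : C | in_ob S x};
  Hom := fun x y => {u : Hom (proj1_sig x) (proj1_sig y) | in_hom S u};
  id := fun x => exist _ (id (proj1_sig x)) (in_hom_id (proj2_sig x));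
  comp := fun x y z v u => exist _ (proj1_sig v ∘ proj1_sig u)
                             (in_hom_comp (proj2_sig v) (proj2_sig u))
|}; intros; apply sig_eq; simpl.
- apply comp_id_l.
- apply comp_id_r.
- apply comp_assoc.
Defined.

Definition Inclusion (C : Category) (S : Subcategory C) : Functor (SubCat S) C.
Proof.
refine {| fob := fun x : SubCat S => proj1_sig x;
          fmap := fun x y (u : Hom x y) => proj1_sig u |}; reflexivity.
Defined.

Definition FullSub (C : Category) (P : C -> Prop) : Subcategory C.
Proof.
refine {| in_ob := P; in_hom := fun _ _ _ => True |}; trivial.
Defined.

(** The unique maps from and to the distinguished zero object are carried as
    data, so that they can be used without a choice principle; [IsWaldhausen]
    says that they are unique. *)
Record WaldStructure (C : Category) := {
  zero : C;
  from_zero : forall x : C, Hom zero x;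
  to_zero : forall x : C, Hom x zero;
  cof : forall x y : C, Hom x y -> Prop;
  weq : forall x y : C, Hom x y -> Prop
}.

Arguments cof {_} _ {_ _} _.
Arguments weq {_} _ {_ _} _.

Record IsWaldhausen (C : Category) (W : WaldStructure C) : Prop := {
  from_zero_unique : forall (x : C) (u : Hom (zero W) x), u = from_zero W x;
  to_zero_unique : forall (x : C) (u : Hom x (zero W)), u = to_zero W x;
  cof_iso : forall (x y : C) (u : Hom x y), IsIso u -> cof W u;
  weq_iso : forall (x y : C) (u : Hom x y), IsIso u -> weq W u;
  cof_comp : forall (x y z : C) (v : Hom y z) (u : Hom x y),
    cof W v -> cof W u -> cof W (v ∘ u);
  weq_comp : forall (x y z : C) (v : Hom y z) (u : Hom x y),
    weq W v -> weq W u -> weq W (v ∘ u);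
  cof_from_zero : forall x : C, cof W (from_zero W x);
  pushout_exists : forall (x y z : C) (u : Hom x y) (v : Hom x z), cof W u ->
    exists (w : C) (p : Hom y w) (q : Hom z w), IsPushout u v p q;
  cof_pushout : forall (x y z w : C)
      (u : Hom x y) (v : Hom x z) (p : Hom y w) (q : Hom z w),
    cof W u -> IsPushout u v p q -> cof W q;
  gluing : forall (a c b p a' c' b' p' : C)
      (u : Hom a c) (v : Hom a b) (k : Hom c p) (l : Hom b p)
      (u' : Hom a' c') (v' : Hom a' b') (k' : Hom c' p') (l' : Hom b' p')
      (ea : Hom a a') (ec : Hom c c') (eb : Hom b b') (ep : Hom p p'),
    cof W u -> cof W u' -> IsPushout u v k l -> IsPushout u' v' k' l' ->
    ec ∘ u = u' ∘ ea -> eb ∘ v = v' ∘ ea ->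
    weq W ea -> weq W ec -> weq W eb ->
    ep ∘ k = k' ∘ ec -> ep ∘ l = l' ∘ eb -> weq W ep
}.

Record Waldhausen := {
  wcat :> Category;
  wstr :> WaldStructure wcat;
  wax : IsWaldhausen wstr
}.

Definition IsQuotient (C : Category) (W : WaldStructure C) (x y z : C)
    (u : Hom x y) (v : Hom y z) : Prop :=
  IsPushout u (to_zero W x) v (from_zero W z).

Definition IsCofiberSequence (C : Category) (W : WaldStructure C) (x y z : C)
    (u : Hom x y) (v : Hom y z) : Prop :=
  cof W u /\ IsQuotient W u v.

(** For a commutative square [a ∘ u = b ∘ v] with corners [x], [y], [z], [t]:
    the induced map from the pushout of [u] and [v] to [t] is a cofibration.
    This would be vacuous without a pushout of [u] and [v], so [u] or [v] should
    be a cofibration of a Waldhausen category. *)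
Definition CornerMapCof (C : Category) (W : WaldStructure C) (x y z t : C)
    (u : Hom x y) (v : Hom x z) (a : Hom y t) (b : Hom z t) : Prop :=
  forall (w : C) (p : Hom y w) (q : Hom z w) (h : Hom w t),
    IsPushout u v p q -> h ∘ p = a -> h ∘ q = b -> cof W h.

Record IsExact (C D : Category) (V : WaldStructure C) (W : WaldStructure D)
    (F : Functor C D) : Prop := {
  exact_zero : F (zero V) = zero W;
  exact_cof : forall (x y : C) (u : Hom x y), cof V u -> cof W (fmap F u);
  exact_weq : forall (x y : C) (u : Hom x y), weq V u -> weq W (fmap F u);
  exact_pushout : forall (x y z w : C)
      (u : Hom x y) (v : Hom x z) (p : Hom y w) (q : Hom z w),
    cof V u -> IsPushout u v p q ->
    IsPushout (fmap F u) (fmap F v) (fmap F p) (fmap F q)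
}.

Definition IsWaldEquivalence (C D : Waldhausen) (F : Functor C D) : Prop :=
  IsExact C D F /\
  exists G : Functor D C, IsExact D C G /\
    NatIsomorphic (G ∘F F) (IdFunctor C) /\ NatIsomorphic (F ∘F G) (IdFunctor D).

Record SubWaldhausen (C : Waldhausen) := {
  sub_cat : Subcategory C;
  sub_str : WaldStructure (SubCat sub_cat);
  sub_ax : IsWaldhausen sub_str;
  sub_zero : proj1_sig (zero sub_str) = zero C;
  sub_cof : forall (x y : SubCat sub_cat) (u : Hom x y),
    cof sub_str u <->
    cof C (proj1_sig u) /\
    exists (z : C) (v : Hom (proj1_sig y) z), IsQuotient C (proj1_sig u) v /\
      exists b : SubCat sub_cat, Isomorphic z (proj1_sig b);
  sub_pushout : forall (x y z w : SubCat sub_cat)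
      (u : Hom x y) (v : Hom x z) (p : Hom y w) (q : Hom z w),
    cof sub_str u -> IsPushout u v p q ->
    IsPushout (proj1_sig u) (proj1_sig v) (proj1_sig p) (proj1_sig q);
  sub_weq : forall (x y : SubCat sub_cat) (u : Hom x y),
    weq sub_str u <-> weq C (proj1_sig u)
}.

Definition SubWald (C : Waldhausen) (A : SubWaldhausen C) : Waldhausen :=
  {| wcat := SubCat (sub_cat A); wstr := sub_str A; wax := sub_ax A |}.

Coercion SubWald : SubWaldhausen >-> Waldhausen.

(** Usually written E/A. *)
Definition RightOrthogonal (A E : Category) (i : Functor A E) : Subcategory E :=
  FullSub (fun e : E => forall a : A,
    exists u : Hom (i a) e, forall v : Hom (i a) e, v = u).

Record IsExactSequence (A E B : Waldhausen) (i : Functor A E) (f : Functor E B) :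
    Prop := {
  seq_exact_i : IsExact A E i;
  seq_exact_f : IsExact E B f;
  seq_zero : forall a : A, f (i a) = zero B;
  seq_ff : FullyFaithful i;
  seq_equiv : IsEquivalence (f ∘F Inclusion (RightOrthogonal i))
}.

Record IsSplitExactSequence (A E B : Waldhausen)
    (i : Functor A E) (f : Functor E B) (j : Functor E A) (g : Functor B E)
    (ij : Adjunction i j) (fg : Adjunction f g) : Prop := {
  split_exact : IsExactSequence i f;
  split_exact_j : IsExact E A j;
  split_exact_g : IsExact B E g;
  split_unit : IsNatIso (adj_unit ij);
  split_counit : IsNatIso (adj_counit fg)
}.

Definition SequencesWaldEquivalent
    (A E B : Waldhausen) (i : Functor A E) (f : Functor E B)
    (A' E' B' : Waldhausen) (i' : Functor A' E') (f' : Functor E' B') : Prop :=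
  exists (PhiA : Functor A A') (PhiE : Functor E E') (PhiB : Functor B B'),
    IsWaldEquivalence PhiA /\ IsWaldEquivalence PhiE /\ IsWaldEquivalence PhiB /\
    NatIsomorphic (PhiE ∘F i) (i' ∘F PhiA) /\
    NatIsomorphic (PhiB ∘F f) (f' ∘F PhiE).

Record ExtOb (C : Waldhausen) (A B : SubWaldhausen C) := {
  ext_sub : A;
  ext_mid : C;
  ext_quo : B;
  ext_inc : Hom (proj1_sig ext_sub) ext_mid;
  ext_prj : Hom ext_mid (proj1_sig ext_quo);
  ext_cofseq : IsCofiberSequence C ext_inc ext_prj
}.

Record ExtHom (C : Waldhausen) (A B : SubWaldhausen C) (X Y : ExtOb A B) := {
  hom_sub : Hom (ext_sub X) (ext_sub Y);
  hom_mid : Hom (ext_mid X) (ext_mid Y);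
  hom_quo : Hom (ext_quo X) (ext_quo Y);
  hom_inc : hom_mid ∘ ext_inc X = ext_inc Y ∘ proj1_sig hom_sub;
  hom_prj : proj1_sig hom_quo ∘ ext_prj X = ext_prj Y ∘ hom_mid
}.

Section Ext.

Variables (C : Waldhausen) (A B : SubWaldhausen C).

Lemma ExtHom_eq (X Y : ExtOb A B) (u v : ExtHom X Y) :
  hom_sub u = hom_sub v -> hom_mid u = hom_mid v -> hom_quo u = hom_quo v ->
  u = v.
Proof.
destruct u as [ua um uq ? ?], v as [va vm vq ? ?]; simpl.
intros; subst; f_equal; apply proof_irrelevance.
Qed.

Definition ext_id (X : ExtOb A B) : ExtHom X X.
Proof.
refine {| hom_sub := id (ext_sub X); hom_mid := id (ext_mid X);
          hom_quo := id (ext_quo X) |}; simpl.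
- now rewrite comp_id_l, comp_id_r.
- now rewrite comp_id_l, comp_id_r.
Defined.

Definition ext_comp (X Y Z : ExtOb A B) (v : ExtHom Y Z) (u : ExtHom X Y) :
  ExtHom X Z.
Proof.
refine {| hom_sub := hom_sub v ∘ hom_sub u; hom_mid := hom_mid v ∘ hom_mid u;
          hom_quo := hom_quo v ∘ hom_quo u |}; simpl.
- now rewrite <- comp_assoc, hom_inc, comp_assoc, hom_inc, <- comp_assoc.
- now rewrite <- comp_assoc, hom_prj, comp_assoc, hom_prj, <- comp_assoc.
Defined.

Definition ExtCat : Category.
Proof.
refine {| Ob := ExtOb A B; Hom := @ExtHom C A B;
          id := ext_id; comp := ext_comp |};
  intros; apply ExtHom_eq;
  first [apply comp_id_l | apply comp_id_r | apply comp_assoc].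
Defined.

Lemma zero_maps_from (z : C) : z = zero C ->
  forall (x : C) (u v : Hom z x), u = v.
Proof.
intros -> x u v.
rewrite (from_zero_unique (wax C) u); symmetry; apply from_zero_unique, wax.
Qed.

Lemma zero_maps_to (z : C) : z = zero C ->
  forall (x : C) (u v : Hom x z), u = v.
Proof.
intros -> x u v.
rewrite (to_zero_unique (wax C) u); symmetry; apply to_zero_unique, wax.
Qed.

Definition zero_map (x y : C) : Hom x y := from_zero C y ∘ to_zero C x.

Lemma cofseq_id_zero (x z : C) : z = zero C ->
  IsCofiberSequence C (id x) (zero_map x z).
Proof.
intros hz; split.
{ apply (cof_iso (wax C)); exists (id x); split; apply comp_id_l. }
split.
{ now rewrite comp_id_r. }
intros t a b e; rewrite comp_id_r in e; subst a.
exists (b ∘ to_zero C z); split.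
- split.
  + unfold zero_map; rewrite <- comp_assoc; f_equal.
    apply (to_zero_unique (wax C)).
  + now apply zero_maps_from.
- intros h _; now apply zero_maps_from.
Qed.

Lemma cofseq_zero_id (x z : C) : z = zero C ->
  IsCofiberSequence C (zero_map z x) (id x).
Proof.
intros ->; split.
{ rewrite (from_zero_unique (wax C) (zero_map _ _)); apply cof_from_zero, wax. }
split.
{ now apply zero_maps_from. }
intros t a b e; exists a; split.
- split; [apply comp_id_r | now apply zero_maps_from].
- intros h [h1 _]; now rewrite comp_id_r in h1.
Qed.

Lemma cofseq_zero (x z : C) : x = zero C -> z = zero C ->
  IsCofiberSequence C (to_zero C x) (from_zero C z).
Proof.
intros hx hz; split.
{ apply (cof_iso (wax C)); exists (from_zero C x); split.
  - now apply zero_maps_from.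
  - now apply zero_maps_from. }
split; [reflexivity |].
intros t a b _; exists (zero_map z t); split.
- split; now apply zero_maps_from.
- intros h _; now apply zero_maps_from.
Qed.

Definition ext_zero : ExtCat :=
  {| ext_sub := zero A; ext_mid := zero C; ext_quo := zero B;
     ext_inc := to_zero C (proj1_sig (zero A));
     ext_prj := from_zero C (proj1_sig (zero B));
     ext_cofseq := cofseq_zero (sub_zero A) (sub_zero B) |}.

Definition ext_from_zero (X : ExtCat) : Hom ext_zero X.
Proof.
refine (@Build_ExtHom C A B ext_zero X (from_zero A _) (from_zero C _)
          (from_zero B _) _ _).
- apply zero_maps_from, sub_zero.
- now apply zero_maps_from.
Defined.

Definition ext_to_zero (X : ExtCat) : Hom X ext_zero.
Proof.
refine (@Build_ExtHom C A B X ext_zero (to_zero A _) (to_zero C _)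
          (to_zero B _) _ _).
- now apply zero_maps_to.
- apply zero_maps_to, sub_zero.
Defined.

Definition ExtStr : WaldStructure ExtCat := {|
  zero := ext_zero;
  from_zero := ext_from_zero;
  to_zero := ext_to_zero;
  cof := fun (X Y : ExtOb A B) (u : ExtHom X Y) =>
    cof A (hom_sub u) /\
    CornerMapCof C (ext_inc X) (proj1_sig (hom_sub u)) (hom_mid u) (ext_inc Y);
  weq := fun (X Y : ExtOb A B) (u : ExtHom X Y) =>
    weq A (hom_sub u) /\ weq C (hom_mid u) /\ weq B (hom_quo u)
|}.

(** [IsWaldhausen ExtStr] is not a consequence of the definitions: since B need
    not be closed under quotients in C, the third component of a cofibration
    need not be a cofibration of B. It is therefore an argument here. *)
Definition ExtWald (H : IsWaldhausen ExtStr) : Waldhausen :=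
  {| wcat := ExtCat; wstr := ExtStr; wax := H |}.

Definition std_i_ob (a : A) : ExtCat :=
  {| ext_sub := a; ext_mid := proj1_sig a; ext_quo := zero B;
     ext_inc := id (proj1_sig a);
     ext_prj := zero_map (proj1_sig a) (proj1_sig (zero B));
     ext_cofseq := cofseq_id_zero (proj1_sig a) (sub_zero B) |}.

Definition std_i_hom (a a' : A) (u : Hom a a') :
  Hom (std_i_ob a) (std_i_ob a').
Proof.
refine (@Build_ExtHom C A B (std_i_ob a) (std_i_ob a')
          u (proj1_sig u) (id (zero B)) _ _).
- simpl; now rewrite comp_id_l, comp_id_r.
- apply zero_maps_to, sub_zero.
Defined.

Definition std_i : Functor A ExtCat.
Proof.
refine {| fob := std_i_ob; fmap := std_i_hom |}.
- intros a; apply ExtHom_eq; reflexivity.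
- intros a a' a'' v u; apply ExtHom_eq; try reflexivity.
  symmetry; apply (comp_id_l (id (zero B))).
Defined.

Definition std_s : Functor ExtCat A.
Proof.
refine (@Build_Functor ExtCat A (fun X => ext_sub X) (fun X Y u => hom_sub u) _ _);
  reflexivity.
Defined.

Definition std_q : Functor ExtCat B.
Proof.
refine (@Build_Functor ExtCat B (fun X => ext_quo X) (fun X Y u => hom_quo u) _ _);
  reflexivity.
Defined.

Definition std_g_ob (b : B) : ExtCat :=
  {| ext_sub := zero A; ext_mid := proj1_sig b; ext_quo := b;
     ext_inc := zero_map (proj1_sig (zero A)) (proj1_sig b);
     ext_prj := id (proj1_sig b);
     ext_cofseq := cofseq_zero_id (proj1_sig b) (sub_zero A) |}.

Definition std_g_hom (b b' : B) (u : Hom b b') :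
  Hom (std_g_ob b) (std_g_ob b').
Proof.
refine (@Build_ExtHom C A B (std_g_ob b) (std_g_ob b')
          (id (zero A)) (proj1_sig u) u _ _).
- apply zero_maps_from, sub_zero.
- simpl; now rewrite comp_id_l, comp_id_r.
Defined.

Definition std_g : Functor B ExtCat.
Proof.
refine {| fob := std_g_ob; fmap := std_g_hom |}.
- intros b; apply ExtHom_eq; reflexivity.
- intros b b' b'' v u; apply ExtHom_eq; try reflexivity.
  symmetry; apply (comp_id_l (id (zero A))).
Defined.

End Ext.

(* Main.v *)
From Stdlib Require Import ProofIrrelevance IndefiniteDescription.
Require Import Defs.

Set Implicit Arguments.
Unset Strict Implicit.
Unset Printing Implicit Defensive.

(** Write T = i j and S = g f for the two exact endofunctors of E, with the counit
    eps : T -> Id and the unit eta : Id -> S. Call an object e torsion if eps_e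
    is an isomorphism and torsion-free if eta_e is one. These two full
    subcategories of E are equivalent to A (through i and j) and to B (through
    g and f), and together they behave like a torsion pair: there are no nonzero
    maps from torsion to torsion-free objects, and every e sits in a cofiber
    sequence T e -> e -> S e ([eps_eta_cofseq]). The latter holds because the
    quotient of eps_e is killed by j, hence lies in E/A, where f detects
    isomorphisms, and f sends the unit of the quotient to an isomorphism. This
    is where the counit has to be a cofibration.

    So take C = E, with the torsion and the torsion-free objects as the sub
    Waldhausen categories. They inherit cofibrations and weak equivalences from
    E and are closed under the pushouts of E, since T and S preserve those.
    Sending e to T e -> e -> S e gives a functor from E to extensions, and
    forgetting all but the middle term goes back. The point is that the middle
    term determines the extension: if a -> e -> b is a cofiber sequence with a
    torsion and b torsion-free, then j a -> j e has quotient j b = 0, so it is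
    an isomorphism, because cofibrations of A with zero quotient are assumed to
    be so; thus a is the coreflection T e of e, and b, being the quotient, is
    S e. Hence [middle] is fully faithful ([middle_ff]), and it reflects weak
    equivalences because T and S preserve them.

    The remaining point is that a map of extensions is a cofibration exactly when
    its middle component is one ([ext_cof_middle]). In one direction the middle
    component is a composite of a pushout of the first component and the corner
    map; in the other, the corner map is the one assumed to be a cofibration
    for the squares of counits. All structure on extensions can then be read off
    in E along [middle]: the Waldhausen axioms, the exactness of the standard
    functors, and the natural isomorphisms that make up the equivalence of
    sequences. *)

(** * Isomorphisms and pushouts *)

Lemma comp_after (C : Category) (x y z : C) (v : Hom y z) (u : Hom x y)
    (w : Hom x z) : v ∘ u = w ->
  forall (t : C) (s : Hom z t), s ∘ v ∘ u = s ∘ w.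
Proof. intros <- t s; symmetry; apply comp_assoc. Qed.

(* Rewrites with an equation between composites of two maps inside a
   left-associated chain. *)
Ltac chain e := first [rewrite e | rewrite (comp_after e)].

Section Pushouts.

Context (C : Category).

Lemma iso_id (x : C) : IsIso (id x).
Proof. exists (id x); split; apply comp_id_l. Qed.

Lemma iso_comp (x y z : C) (v : Hom y z) (u : Hom x y) :
  IsIso v -> IsIso u -> IsIso (v ∘ u).
Proof.
intros [v' [v1 v2]] [u' [u1 u2]]; exists (u' ∘ v'); split.
- rewrite comp_assoc; chain v1; now rewrite comp_id_r.
- rewrite comp_assoc; chain u2; now rewrite comp_id_r.
Qed.

Lemma iso_cancel_l (x y z : C) (v : Hom y z) (u : Hom x y) :
  IsIso v -> IsIso (v ∘ u) -> IsIso u.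
Proof.
intros [v' [v1 v2]] [w [w1 w2]]; exists (w ∘ v); split.
- now rewrite <- comp_assoc.
- rewrite <- (comp_id_l (u ∘ (w ∘ v))), <- v1, !comp_assoc.
  rewrite <- (comp_assoc v' v u), <- (comp_assoc v' _ w), w2.
  now rewrite comp_id_r.
Qed.

Lemma iso_cancel_r (x y z : C) (v : Hom y z) (u : Hom x y) :
  IsIso u -> IsIso (v ∘ u) -> IsIso v.
Proof.
intros [u' [u1 u2]] [w [w1 w2]]; exists (u ∘ w); split.
- rewrite <- (comp_id_r (u ∘ w ∘ v)), <- u2, !comp_assoc.
  rewrite <- (comp_assoc (u ∘ w) v u), <- (comp_assoc u w (v ∘ u)), w1.
  now rewrite comp_id_r.
- now rewrite comp_assoc.
Qed.

Lemma iso_mono (x y z : C) (v : Hom y z) (a b : Hom x y) :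
  IsIso v -> v ∘ a = v ∘ b -> a = b.
Proof.
intros [v' [v1 _]] e.
now rewrite <- (comp_id_l a), <- (comp_id_l b), <- v1, <- !comp_assoc, e.
Qed.

Lemma iso_epi (x y z : C) (u : Hom x y) (a b : Hom y z) :
  IsIso u -> a ∘ u = b ∘ u -> a = b.
Proof.
intros [u' [_ u2]] e.
now rewrite <- (comp_id_r a), <- (comp_id_r b), <- u2, !comp_assoc, e.
Qed.

Lemma pushout_sym (x y z w : C)
    (u : Hom x y) (v : Hom x z) (p : Hom y w) (q : Hom z w) :
  IsPushout u v p q -> IsPushout v u q p.
Proof.
intros [e univ]; split; [easy |].
intros t a b eab; destruct (univ t b a (eq_sym eab)) as [h [[hp hq] hu]].
exists h; split; [easy |].
intros k [k1 k2]; now apply hu.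
Qed.

Lemma pushout_ext (x y z w : C)
    (u : Hom x y) (v : Hom x z) (p : Hom y w) (q : Hom z w) :
  IsPushout u v p q -> forall (t : C) (h k : Hom w t),
  h ∘ p = k ∘ p -> h ∘ q = k ∘ q -> h = k.
Proof.
intros [e univ] t h k hp hq.
destruct (univ t (k ∘ p) (k ∘ q)) as [m [_ mu]].
{ now rewrite <- !comp_assoc, e. }
now rewrite <- (mu h), <- (mu k).
Qed.

(** The setting is a map between two commutative squares, with components [ex],
    [ey], [ez], [ew]. *)
Section PushoutMaps.

Context (x y z w x' y' z' w' : C)
  (u : Hom x y) (v : Hom x z) (p : Hom y w) (q : Hom z w)
  (u' : Hom x' y') (v' : Hom x' z') (p' : Hom y' w') (q' : Hom z' w')
  (ex : Hom x x') (ey : Hom y y') (ez : Hom z z') (ew : Hom w w').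

Lemma pushout_map_iso :
  IsPushout u v p q -> IsPushout u' v' p' q' ->
  ey ∘ u = u' ∘ ex -> ez ∘ v = v' ∘ ex ->
  ew ∘ p = p' ∘ ey -> ew ∘ q = q' ∘ ez ->
  IsIso ex -> IsIso ey -> IsIso ez -> IsIso ew.
Proof.
intros po po' eu ev ep eq [ix [x1 x2]] [iy [y1 y2]] [iz [z1 z2]].
destruct (proj2 po' w (p ∘ iy) (q ∘ iz)) as [k [[k1 k2] _]].
{ rewrite <- (comp_id_r u'), <- (comp_id_r v'), <- x2, !comp_assoc.
  rewrite <- (comp_assoc _ u' ex), <- (comp_assoc _ v' ex), <- eu, <- ev.
  rewrite !comp_assoc; chain y1; chain z1.
  now rewrite !comp_id_r, (proj1 po). }
exists k; split.
- apply (pushout_ext po); rewrite comp_id_l, <- comp_assoc.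
  + rewrite ep, comp_assoc, k1; chain y1; apply comp_id_r.
  + rewrite eq, comp_assoc, k2; chain z1; apply comp_id_r.
- apply (pushout_ext po'); rewrite comp_id_l, <- comp_assoc.
  + rewrite k1, comp_assoc, ep; chain y2; apply comp_id_r.
  + rewrite k2, comp_assoc, eq; chain z2; apply comp_id_r.
Qed.

Lemma pushout_transport :
  IsPushout u v p q ->
  ey ∘ u = u' ∘ ex -> ez ∘ v = v' ∘ ex ->
  ew ∘ p = p' ∘ ey -> ew ∘ q = q' ∘ ez ->
  IsIso ex -> IsIso ey -> IsIso ez -> IsIso ew ->
  IsPushout u' v' p' q'.
Proof.
intros [e univ] eu ev ep eq hx hy hz [iw [w1 w2]]; split.
{ apply (iso_epi hx).
  rewrite <- !comp_assoc, <- eu, <- ev, !comp_assoc, <- ep, <- eq.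
  now rewrite <- !comp_assoc, e. }
intros t a b eab.
destruct (univ t (a ∘ ey) (b ∘ ez)) as [h [[h1 h2] hu]].
{ rewrite <- !comp_assoc, eu, ev, !comp_assoc; now rewrite eab. }
exists (h ∘ iw); split; [split |].
- apply (iso_epi hy); rewrite <- comp_assoc, <- ep, comp_assoc.
  chain w1; now rewrite comp_id_r.
- apply (iso_epi hz); rewrite <- comp_assoc, <- eq, comp_assoc.
  chain w1; now rewrite comp_id_r.
- intros k [k1 k2]; rewrite (hu (k ∘ ew)).
  + chain w2; apply comp_id_r.
  + now rewrite <- !comp_assoc, ep, eq, !comp_assoc, k1, k2.
Qed.

End PushoutMaps.

Lemma pushout_unique (x y z w w' : C)
    (u : Hom x y) (v : Hom x z) (p : Hom y w) (q : Hom z w)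
    (p' : Hom y w') (q' : Hom z w') :
  IsPushout u v p q -> IsPushout u v p' q' ->
  exists h : Hom w w', IsIso h /\ h ∘ p = p' /\ h ∘ q = q'.
Proof.
intros po po'.
destruct (proj2 po w' p' q' (proj1 po')) as [h [[h1 h2] _]].
exists h; split; [| easy].
apply (@pushout_map_iso x y z w x y z w' u v p q u v p' q'
         (id x) (id y) (id z) h); try apply iso_id; try easy.
all: now rewrite ?comp_id_l, ?comp_id_r.
Qed.

Lemma pushout_of_iso (x y z w : C)
    (u : Hom x y) (v : Hom x z) (p : Hom y w) (q : Hom z w) :
  IsPushout u v p q -> IsIso v -> IsIso p.
Proof.
intros [e univ] [v' [v1 v2]].
destruct (univ y (id y) (u ∘ v')) as [h [[h1 h2] _]].
{ rewrite comp_id_l; chain v1; now rewrite comp_id_r. }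
exists h; split; [easy |].
apply (pushout_ext (conj e univ)); rewrite comp_id_l, <- comp_assoc.
- now rewrite h1, comp_id_r.
- rewrite h2, comp_assoc, e; chain v2; apply comp_id_r.
Qed.

End Pushouts.

(** * Functors and natural isomorphisms *)

Lemma iso_fmap (C D : Category) (F : Functor C D) (x y : C) (u : Hom x y) :
  IsIso u -> IsIso (fmap F u).
Proof.
intros [v [v1 v2]]; exists (fmap F v).
now rewrite <- !fmap_comp, v1, v2, !fmap_id.
Qed.

(** The inverses of the components exist only propositionally, so a choice
    principle is needed to collect them into a natural transformation. *)
Lemma nat_isomorphic_sym (C D : Category) (F G : Functor C D) :
  NatIsomorphic F G -> NatIsomorphic G F.
Proof.
intros [t ht].
pose (inv x := constructive_indefinite_description _ (ht x)).
unshelve eexists.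
{ refine {| component := fun x => proj1_sig (inv x) |}.
  intros x y u; destruct (inv x) as [s [s1 s2]], (inv y) as [r [r1 r2]]; simpl.
  apply (iso_mono (ht y)); rewrite !comp_assoc, naturality, r2, comp_id_l.
  chain s2; now rewrite comp_id_r. }
intros x; simpl; destruct (inv x) as [s [s1 s2]]; simpl; now exists (t x).
Qed.

Lemma nat_isomorphic_trans (C D : Category) (F G H : Functor C D) :
  NatIsomorphic F G -> NatIsomorphic G H -> NatIsomorphic F H.
Proof.
intros [t ht] [s hs]; unshelve eexists.
{ refine {| component := fun x => s x ∘ t x |}.
  intros x y u.
  now rewrite <- comp_assoc, naturality, comp_assoc, naturality, comp_assoc. }
intros x; now apply iso_comp.
Qed.

(** Naturality makes [u] conjugate to its image under the composite of [F] with
    its inverse. *)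
Lemma equivalence_reflects_iso (C D : Category) (F : Functor C D) :
  IsEquivalence F ->
  forall (x y : C) (u : Hom x y), IsIso (fmap F u) -> IsIso u.
Proof.
intros [G [[t ht] _]] x y u hu.
assert (h : IsIso (t y ∘ fmap (G ∘F F) u)).
{ apply iso_comp; [apply ht | exact (iso_fmap G hu)]. }
rewrite (naturality t u) in h; exact (iso_cancel_r (ht x) h).
Qed.

Section FullyFaithfulFunctors.

Context (D E : Category) (F : Functor D E) (ff : FullyFaithful F).

Lemma ff_faithful (x y : D) (u v : Hom x y) : fmap F u = fmap F v -> u = v.
Proof.
intros e; destruct (ff (fmap F v)) as [w [_ wu]].
now rewrite <- (wu u e), <- (wu v).
Qed.

Lemma ff_full (x y : D) (v : Hom (F x) (F y)) : exists u, fmap F u = v.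
Proof. destruct (ff v) as [u [e _]]; now exists u. Qed.

Lemma ff_reflects_iso (x y : D) (u : Hom x y) : IsIso (fmap F u) -> IsIso u.
Proof.
intros [v [v1 v2]]; destruct (ff_full v) as [w <-]; exists w.
split; apply ff_faithful; now rewrite fmap_comp, fmap_id.
Qed.

Lemma ff_reflects_pushout (x y z w : D)
    (u : Hom x y) (v : Hom x z) (p : Hom y w) (q : Hom z w) :
  IsPushout (fmap F u) (fmap F v) (fmap F p) (fmap F q) -> IsPushout u v p q.
Proof.
intros [e univ]; split.
{ apply ff_faithful; now rewrite !fmap_comp. }
intros t a b eab.
destruct (univ (F t) (fmap F a) (fmap F b)) as [h [[h1 h2] hu]].
{ now rewrite <- !fmap_comp, eab. }
destruct (ff_full h) as [k <-]; exists k; split; [split |].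
- apply ff_faithful; now rewrite fmap_comp.
- apply ff_faithful; now rewrite fmap_comp.
- intros k' [k1 k2]; apply ff_faithful, hu.
  now rewrite <- !fmap_comp, k1, k2.
Qed.

(** This lets functors be compared after an embedding, where in every application
    below they agree on objects and maps. *)
Lemma ff_reflects_nat_isomorphic (C : Category) (G H : Functor C D) :
  NatIsomorphic (F ∘F G) (F ∘F H) -> NatIsomorphic G H.
Proof.
intros [t ht].
pose (lift x := constructive_indefinite_description _ (ff_full (t x))).
unshelve eexists.
{ refine {| component := fun x => proj1_sig (lift x) |}.
  intros x y u; apply ff_faithful; rewrite !fmap_comp.
  destruct (lift x) as [a ea], (lift y) as [b eb]; simpl; rewrite ea, eb.
  apply (naturality t u). }
intros x; apply ff_reflects_iso; simpl.
destruct (lift x) as [a ea]; simpl; rewrite ea; apply ht.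
Qed.

Lemma ff_of_comp (C : Category) (G : Functor C D) :
  FullyFaithful (F ∘F G) -> FullyFaithful G.
Proof.
intros hFG x y v; destruct (hFG x y (fmap F v)) as [u [e uu]].
exists u; split; [now apply ff_faithful |].
intros u' <-; now apply uu.
Qed.

End FullyFaithfulFunctors.

(** * Zero objects *)

Section ZeroObjects.

Context (C : Waldhausen).

Definition IsZero (x : C) : Prop := IsIso (to_zero C x).

Lemma maps_to_zero (x : C) : IsZero x -> forall (y : C) (u v : Hom y x), u = v.
Proof.
intros hx y u v; apply (iso_mono hx); now apply zero_maps_to.
Qed.

Lemma maps_from_zero (x : C) :
  IsZero x -> forall (y : C) (u v : Hom x y), u = v.
Proof.
intros [k [k1 k2]] y u v; rewrite <- (comp_id_r u), <- (comp_id_r v), <- k1.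
rewrite !comp_assoc; f_equal; now apply zero_maps_from.
Qed.

(** An object is zero as soon as its identity factors through a zero object. *)
Lemma is_zero_of_factor (x z : C) (r : Hom z x) (s : Hom x z) :
  IsZero z -> r ∘ s = id x -> IsZero x.
Proof.
intros hz e; exists (r ∘ from_zero C z); split.
- rewrite <- e, <- comp_assoc; f_equal; now apply maps_to_zero.
- now apply zero_maps_to.
Qed.

Lemma is_zero_eq (x : C) : x = zero C -> IsZero x.
Proof.
intros e; exists (from_zero C x); split; [now apply zero_maps_from |].
now apply zero_maps_from.
Qed.

Lemma is_zero_iso (x y : C) (u : Hom x y) : IsIso u -> IsZero y -> IsZero x.
Proof. intros [v [v1 _]] hy; now apply (is_zero_of_factor hy v1). Qed.

Lemma is_zero_iso_inv (x y : C) (u : Hom x y) : IsIso u -> IsZero x -> IsZero y.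
Proof. intros [v [_ v2]] hx; now apply (is_zero_of_factor hx v2). Qed.

Lemma map_of_zeros_iso (x y : C) (u : Hom x y) :
  IsZero x -> IsZero y -> IsIso u.
Proof.
intros hx hy; exists (from_zero C x ∘ to_zero C y).
split; [now apply maps_to_zero | now apply maps_to_zero].
Qed.

Lemma cof_from_eq_zero (z x : C) (u : Hom z x) : z = zero C -> cof C u.
Proof.
intros e; revert u; rewrite e; intros u.
rewrite (from_zero_unique (wax C) u); apply cof_from_zero, wax.
Qed.

End ZeroObjects.

(** * Exactness up to isomorphism *)

(** The part of exactness that does not speak of equality of objects, and is
    therefore invariant under natural isomorphism. *)
Record Preserves (C D : Category) (V : WaldStructure C) (W : WaldStructure D)
    (F : Functor C D) : Prop := {
  pres_cof : forall (x y : C) (u : Hom x y), cof V u -> cof W (fmap F u);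
  pres_weq : forall (x y : C) (u : Hom x y), weq V u -> weq W (fmap F u);
  pres_pushout : forall (x y z w : C)
      (u : Hom x y) (v : Hom x z) (p : Hom y w) (q : Hom z w),
    cof V u -> IsPushout u v p q ->
    IsPushout (fmap F u) (fmap F v) (fmap F p) (fmap F q)
}.

Lemma exact_preserves (C D : Category) (V : WaldStructure C)
    (W : WaldStructure D) (F : Functor C D) : IsExact V W F -> Preserves V W F.
Proof.
intros [h0 hc hw hp]; now constructor.
Qed.

Lemma exact_of_preserves (C D : Category) (V : WaldStructure C)
    (W : WaldStructure D) (F : Functor C D) :
  F (zero V) = zero W -> Preserves V W F -> IsExact V W F.
Proof.
intros h0 [hc hw hp]; now constructor.
Qed.

Lemma preserves_comp (C D E : Category) (U : WaldStructure C)
    (V : WaldStructure D) (W : WaldStructure E)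
    (G : Functor D E) (F : Functor C D) :
  Preserves V W G -> Preserves U V F -> Preserves U W (G ∘F F).
Proof.
intros hG hF; constructor; simpl.
- intros; now apply (pres_cof hG), (pres_cof hF).
- intros; now apply (pres_weq hG), (pres_weq hF).
- intros x y z w u v p q hu hp; apply (pres_pushout hG).
  + now apply (pres_cof hF).
  + now apply (pres_pushout hF).
Qed.

Lemma exact_comp (C D E : Category) (U : WaldStructure C)
    (V : WaldStructure D) (W : WaldStructure E)
    (G : Functor D E) (F : Functor C D) :
  IsExact V W G -> IsExact U V F -> IsExact U W (G ∘F F).
Proof.
intros hG hF; apply exact_of_preserves.
- simpl; now rewrite (exact_zero hF), (exact_zero hG).
- apply (@preserves_comp _ _ _ U V W); now apply exact_preserves.
Qed.

Section Conjugation.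

Context (D : Waldhausen) (x y x' y' : D) (u : Hom x y) (u' : Hom x' y')
  (ex : Hom x x') (ey : Hom y y')
  (e : ey ∘ u = u' ∘ ex) (hx : IsIso ex) (hy : IsIso ey).

Lemma cof_conj : cof D u <-> cof D u'.
Proof.
split; intros h.
- destruct hx as [ix [x1 x2]].
  assert (k : u' = ey ∘ u ∘ ix).
  { rewrite e; chain x2; now rewrite comp_id_r. }
  rewrite k; apply (cof_comp (wax D)).
  + apply (cof_comp (wax D)); [now apply (cof_iso (wax D)) | easy].
  + apply (cof_iso (wax D)); now exists ex.
- destruct hy as [iy [y1 y2]].
  assert (k : u = iy ∘ (u' ∘ ex)).
  { now rewrite <- e, comp_assoc, y1, comp_id_l. }
  rewrite k; apply (cof_comp (wax D)).
  + apply (cof_iso (wax D)); now exists ey.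
  + apply (cof_comp (wax D)); [easy | now apply (cof_iso (wax D))].
Qed.

Lemma weq_conj : weq D u <-> weq D u'.
Proof.
split; intros h.
- destruct hx as [ix [x1 x2]].
  assert (k : u' = ey ∘ u ∘ ix).
  { rewrite e; chain x2; now rewrite comp_id_r. }
  rewrite k; apply (weq_comp (wax D)).
  + apply (weq_comp (wax D)); [now apply (weq_iso (wax D)) | easy].
  + apply (weq_iso (wax D)); now exists ex.
- destruct hy as [iy [y1 y2]].
  assert (k : u = iy ∘ (u' ∘ ex)).
  { now rewrite <- e, comp_assoc, y1, comp_id_l. }
  rewrite k; apply (weq_comp (wax D)).
  + apply (weq_iso (wax D)); now exists ey.
  + apply (weq_comp (wax D)); [easy | now apply (weq_iso (wax D))].
Qed.

End Conjugation.

Lemma preserves_nat_isomorphic (C : Category) (V : WaldStructure C)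
    (D : Waldhausen) (F G : Functor C D) :
  NatIsomorphic F G -> Preserves V D F -> Preserves V D G.
Proof.
intros [t ht] [hc hw hp]; constructor.
- intros x y u hu; rewrite <- (cof_conj (naturality t u)); auto.
- intros x y u hu; rewrite <- (weq_conj (naturality t u)); auto.
- intros x y z w u v p q hu po.
  apply (pushout_transport (hp _ _ _ _ _ _ _ _ hu po)
           (naturality t u) (naturality t v) (naturality t p) (naturality t q));
    apply ht.
Qed.

(** ** Embeddings *)

(** The structure on the source is completely determined by the one on the
    target. The two uses are inclusions of full subcategories and the functor
    from extensions to their middle terms. *)
Record Embedding (D E : Category) (V : WaldStructure D) (W : WaldStructure E)
    (F : Functor D E) : Prop := {
  emb_ff : FullyFaithful F;
  emb_zero : F (zero V) = zero W;
  emb_cof : forall (x y : D) (u : Hom x y), cof V u <-> cof W (fmap F u);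
  emb_weq : forall (x y : D) (u : Hom x y), weq V u <-> weq W (fmap F u)
}.

Lemma embedding_reflects_preserves (C D E : Category) (U : WaldStructure C)
    (V : WaldStructure D) (W : WaldStructure E)
    (F : Functor D E) (G : Functor C D) :
  Embedding V W F -> Preserves U W (F ∘F G) -> Preserves U V G.
Proof.
intros hF [hc hw hp]; constructor.
- intros x y u hu; apply (emb_cof hF); now apply hc.
- intros x y u hu; apply (emb_weq hF); now apply hw.
- intros x y z w u v p q hu po; apply (ff_reflects_pushout (emb_ff hF)).
  now apply hp.
Qed.

(** The Waldhausen axioms pull back along an embedding as soon as the pushouts
    along cofibrations, taken in the target, can be represented by objects of the
    source. *)

Section Lifting.

Context (D : Category) (V : WaldStructure D) (E : Waldhausen)
  (F : Functor D E) (hF : Embedding V E F)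
  (lift : forall (x y z : D) (u : Hom x y) (v : Hom x z), cof V u ->
    exists (w : D) (p : Hom y w) (q : Hom z w),
      IsPushout (fmap F u) (fmap F v) (fmap F p) (fmap F q)).

(** A pushout in the source is isomorphic to the lifted one, whose image is a
    pushout. *)
Lemma embedding_pushout (x y z w : D)
    (u : Hom x y) (v : Hom x z) (p : Hom y w) (q : Hom z w) :
  cof V u -> IsPushout u v p q ->
  IsPushout (fmap F u) (fmap F v) (fmap F p) (fmap F q).
Proof.
intros hu po; destruct (lift v hu) as [w' [p' [q' po']]].
destruct (pushout_unique (ff_reflects_pushout (emb_ff hF) po') po)
  as [h [hh [hp hq]]].
apply (@pushout_transport _ _ _ _ _ _ _ _ _ _ _ _ _ _ _ _ _
         (id _) (id _) (id _) (fmap F h) po');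
  rewrite ?comp_id_l, ?comp_id_r, <- ?fmap_comp, ?hp, ?hq;
  try easy; try apply iso_id; now apply iso_fmap.
Qed.

Lemma embedding_exact : IsExact V E F.
Proof.
constructor.
- apply (emb_zero hF).
- intros x y u; now apply (emb_cof hF).
- intros x y u; now apply (emb_weq hF).
- apply embedding_pushout.
Qed.

Lemma embedding_waldhausen : IsWaldhausen V.
Proof.
pose proof (emb_ff hF) as ff; constructor.
- intros x u; apply (ff_faithful ff), zero_maps_from, (emb_zero hF).
- intros x u; apply (ff_faithful ff), zero_maps_to, (emb_zero hF).
- intros x y u hu; apply (emb_cof hF), (cof_iso (wax E)); now apply iso_fmap.
- intros x y u hu; apply (emb_weq hF), (weq_iso (wax E)); now apply iso_fmap.
- intros x y z v u hv hu; apply (emb_cof hF); rewrite fmap_comp.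
  apply (cof_comp (wax E)); now apply (emb_cof hF).
- intros x y z v u hv hu; apply (emb_weq hF); rewrite fmap_comp.
  apply (weq_comp (wax E)); now apply (emb_weq hF).
- intros x; apply (emb_cof hF), cof_from_eq_zero, (emb_zero hF).
- intros x y z u v hu; destruct (lift v hu) as [w [p [q po]]].
  exists w, p, q; now apply (ff_reflects_pushout ff).
- intros x y z w u v p q hu po; apply (emb_cof hF).
  apply (@cof_pushout _ _ (wax E) _ _ _ _ (fmap F u) (fmap F v) (fmap F p)).
  + now apply (emb_cof hF).
  + now apply embedding_pushout.
- intros a c b p a' c' b' p' u v k l u' v' k' l' ea ec eb ep
    hu hu' po po' e1 e2 wa wc wb e3 e4.
  apply (emb_weq hF).
  apply (@gluing _ _ (wax E) _ _ _ _ _ _ _ _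
           (fmap F u) (fmap F v) (fmap F k) (fmap F l)
           (fmap F u') (fmap F v') (fmap F k') (fmap F l')
           (fmap F ea) (fmap F ec) (fmap F eb));
    try (now apply (emb_cof hF)); try (now apply (emb_weq hF));
    try (now apply embedding_pushout);
    rewrite <- !fmap_comp; f_equal; assumption.
Qed.

End Lifting.

(** * Full sub Waldhausen categories *)

Lemma inclusion_ff (C : Category) (P : C -> Prop) :
  FullyFaithful (Inclusion (FullSub P)).
Proof.
intros x y v; exists (exist (fun _ => True) v I); split; [easy |].
intros u e; now apply sig_eq.
Qed.

Section FullSubWaldhausen.

Context (E : Waldhausen) (P : E -> Prop) (P_zero : P (zero E))
  (P_pushout : forall (x y z w : E)
      (u : Hom x y) (v : Hom x z) (p : Hom y w) (q : Hom z w),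
    cof E u -> IsPushout u v p q -> P x -> P y -> P z -> P w).

Definition full_str : WaldStructure (SubCat (FullSub P)) :=
  @Build_WaldStructure (SubCat (FullSub P))
    (exist P (zero E) P_zero)
    (fun x => exist (fun _ => True) (from_zero E (proj1_sig x)) I)
    (fun x => exist (fun _ => True) (to_zero E (proj1_sig x)) I)
    (fun x y u => cof E (proj1_sig u))
    (fun x y u => weq E (proj1_sig u)).

Lemma full_embedding : Embedding full_str E (Inclusion (FullSub P)).
Proof. constructor; [apply inclusion_ff | easy | easy | easy]. Qed.

(** The source of all properties of a full subcategory closed under pushouts: its
    pushouts are computed in the ambient category. *)
Lemma full_lift (x y z : SubCat (FullSub P)) (u : Hom x y) (v : Hom x z) :
  cof full_str u ->
  exists (w : SubCat (FullSub P)) (p : Hom y w) (q : Hom z w),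
    IsPushout (proj1_sig u) (proj1_sig v) (proj1_sig p) (proj1_sig q).
Proof.
intros hu.
destruct (pushout_exists (wax E) (proj1_sig v) hu) as [w [p [q po]]].
pose (w' := exist P w (P_pushout hu po (proj2_sig x) (proj2_sig y) (proj2_sig z))
            : SubCat (FullSub P)).
exists w', (exist (fun _ => True) p I), (exist (fun _ => True) q I).
exact po.
Qed.

Lemma full_waldhausen : IsWaldhausen full_str.
Proof. exact (embedding_waldhausen full_embedding full_lift). Qed.

Lemma inclusion_exact : IsExact full_str E (Inclusion (FullSub P)).
Proof. exact (embedding_exact full_embedding full_lift). Qed.

Definition FullSubWald : SubWaldhausen E.
Proof.
refine {| sub_cat := FullSub P; sub_str := full_str; sub_ax := full_waldhausen |}.
- reflexivity.
- intros x y u; split; [intros hu; split; [exact hu |] | intros hu; apply hu].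
  destruct (full_lift (to_zero full_str x) hu) as [w [p [q po]]].
  exists (proj1_sig w), (proj1_sig p); split.
  + unfold IsQuotient.
    rewrite <- (from_zero_unique (wax E) (proj1_sig q)); exact po.
  + exists w, (id _); apply iso_id.
- intros x y z w u v p q hu po; exact (exact_pushout inclusion_exact hu po).
- easy.
Defined.

End FullSubWaldhausen.

(** * The torsion decomposition of a split exact sequence *)

Section SplitSequence.

Context (A E B : Waldhausen)
  (i : Functor A E) (f : Functor E B) (j : Functor E A) (g : Functor B E)
  (ij : Adjunction i j) (fg : Adjunction f g)
  (Hsplit : IsSplitExactSequence ij fg).

Local Notation T := (i ∘F j).
Local Notation S := (g ∘F f).

Definition eps (e : E) : Hom (T e) e := adj_counit ij e.
Definition eta (e : E) : Hom e (S e) := adj_unit fg e.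

Lemma eps_nat (e e' : E) (u : Hom e e') : eps e' ∘ fmap T u = u ∘ eps e.
Proof. apply (naturality (adj_counit ij) u). Qed.

Lemma eta_nat (e e' : E) (u : Hom e e') : eta e' ∘ u = fmap S u ∘ eta e.
Proof. apply (naturality (adj_unit fg) u). Qed.

Lemma exact_i : IsExact A E i.
Proof. apply Hsplit. Qed.

Lemma exact_f : IsExact E B f.
Proof. apply Hsplit. Qed.

Lemma exact_j : IsExact E A j.
Proof. apply Hsplit. Qed.

Lemma exact_g : IsExact B E g.
Proof. apply Hsplit. Qed.

Lemma exact_T : IsExact E E T.
Proof. exact (exact_comp exact_i exact_j). Qed.

Lemma exact_S : IsExact E E S.
Proof. exact (exact_comp exact_g exact_f). Qed.

Lemma eps_i_iso (a : A) : IsIso (eps (i a)).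
Proof.
apply (@iso_cancel_r _ _ _ _ _ (fmap i (adj_unit ij a))).
- apply iso_fmap, (split_unit Hsplit).
- pose proof (triangle_l ij a) as e; unfold eps; simpl in *; rewrite e.
  apply iso_id.
Qed.

Lemma j_eps_iso (e : E) : IsIso (fmap j (eps e)).
Proof.
apply (@iso_cancel_r _ _ _ _ _ (adj_unit ij (j e))).
- apply (split_unit Hsplit).
- pose proof (triangle_r ij e) as t; unfold eps; simpl in *; rewrite t.
  apply iso_id.
Qed.

Lemma eta_g_iso (b : B) : IsIso (eta (g b)).
Proof.
apply (@iso_cancel_l _ _ _ _ (fmap g (adj_counit fg b))).
- apply iso_fmap, (split_counit Hsplit).
- pose proof (triangle_r fg b) as t; unfold eta; simpl in *; rewrite t.
  apply iso_id.
Qed.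

Lemma f_eta_iso (e : E) : IsIso (fmap f (eta e)).
Proof.
apply (@iso_cancel_l _ _ _ _ (adj_counit fg (f e))).
- apply (split_counit Hsplit).
- pose proof (triangle_l fg e) as t; unfold eta; simpl in *; rewrite t.
  apply iso_id.
Qed.

(** Since the unit of [i] and [j] and the counit of [f] and [g] are invertible,
    these are the essential images of [i] and of [g]. Unlike the images they come
    with a functorial way back, namely [j] and [f]. *)
Definition Torsion (e : E) : Prop := IsIso (eps e).
Definition TorsionFree (e : E) : Prop := IsIso (eta e).

Lemma torsion_zero : Torsion (zero E).
Proof.
apply map_of_zeros_iso; [| now apply is_zero_eq].
apply is_zero_eq, (exact_zero exact_T).
Qed.

Lemma torsion_free_zero : TorsionFree (zero E).
Proof.
apply map_of_zeros_iso; [now apply is_zero_eq |].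
apply is_zero_eq, (exact_zero exact_S).
Qed.

(** [T] preserves the pushout, so [eps] is a map of pushout squares and is
    invertible at the pushout as soon as it is at the other three corners. *)
Lemma torsion_pushout (x y z w : E)
    (u : Hom x y) (v : Hom x z) (p : Hom y w) (q : Hom z w) :
  cof E u -> IsPushout u v p q ->
  Torsion x -> Torsion y -> Torsion z -> Torsion w.
Proof.
intros hu po.
apply (pushout_map_iso (exact_pushout exact_T hu po) po);
  apply eps_nat.
Qed.

Lemma torsion_free_pushout (x y z w : E)
    (u : Hom x y) (v : Hom x z) (p : Hom y w) (q : Hom z w) :
  cof E u -> IsPushout u v p q ->
  TorsionFree x -> TorsionFree y -> TorsionFree z -> TorsionFree w.
Proof.
intros hu po.
apply (pushout_map_iso po (exact_pushout exact_S hu po));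
  apply eta_nat.
Qed.

Definition TorsionPart : SubWaldhausen E :=
  FullSubWald torsion_zero torsion_pushout.

Definition TorsionFreePart : SubWaldhausen E :=
  FullSubWald torsion_free_zero torsion_free_pushout.

Lemma f_torsion_zero (e : E) : Torsion e -> IsZero (f e).
Proof.
intros he; apply (is_zero_iso_inv (iso_fmap f he)), is_zero_eq.
apply (seq_zero (split_exact Hsplit)).
Qed.

(** By adjunction such maps correspond to maps out of [f (i a)], which is zero. *)
Lemma maps_i_g (a : A) (b : B) (u v : Hom (i a) (g b)) : u = v.
Proof.
apply (iso_mono (eta_g_iso b)); rewrite !eta_nat; f_equal; simpl.
f_equal; apply maps_from_zero, is_zero_eq.
apply (seq_zero (split_exact Hsplit)).
Qed.

(** The counit from [T (g b)] to [g b] goes from torsion to torsion-free, so it is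
    zero; but [j] makes it invertible. *)
Lemma j_g_zero (b : B) : IsZero (j (g b)).
Proof.
destruct (j_eps_iso (g b)) as [k [_ k2]].
assert (hz : IsZero (j (zero E))).
{ apply is_zero_eq, (exact_zero exact_j). }
apply (@is_zero_of_factor _ _ _
         (fmap j (from_zero E (g b))) (fmap j (to_zero E (T (g b))) ∘ k) hz).
rewrite comp_assoc, <- fmap_comp, <- k2; f_equal; f_equal.
apply (@maps_i_g (j (g b)) b).
Qed.

Lemma j_torsion_free_zero (e : E) : TorsionFree e -> IsZero (j e).
Proof.
intros he; exact (is_zero_iso (iso_fmap j he) (j_g_zero (f e))).
Qed.

Lemma orthogonal_of_j_zero (e : E) :
  IsZero (j e) -> in_ob (RightOrthogonal i) e.
Proof.
intros he a; exists (from_zero E e ∘ to_zero E (i a)); intros v.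
apply (iso_epi (eps_i_iso a)); rewrite <- !eps_nat; f_equal; simpl.
f_equal; now apply maps_to_zero.
Qed.

(** Both [e] and [S e] lie in E/A, on which [f] is an equivalence, and [f] inverts
    the unit. *)
Lemma eta_iso_of_j_zero (e : E) : IsZero (j e) -> TorsionFree e.
Proof.
intros he.
pose (e1 := exist _ e (orthogonal_of_j_zero he)
            : SubCat (RightOrthogonal i)).
pose (e2 := exist _ (S e) (orthogonal_of_j_zero (j_g_zero (f e)))
            : SubCat (RightOrthogonal i)).
pose (h := exist (fun _ => True) (eta e) I : Hom e1 e2).
apply (iso_fmap (Inclusion (RightOrthogonal i)) (u := h)).
apply (equivalence_reflects_iso (seq_equiv (split_exact Hsplit))).
apply f_eta_iso.
Qed.

Context (Hcounit : forall e : E, cof E (adj_counit ij e)).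

(** The actual quotient [w] of the counit is torsion-free, as [j] kills it. As [f]
    kills [T e], the projection from [e] to [w] becomes invertible under [S], so
    [w] is isomorphic to [S w] and to [S e], compatibly with the maps from [e]. *)
Lemma eps_eta_cofseq (e : E) : IsCofiberSequence E (eps e) (eta e).
Proof.
assert (hc : cof E (eps e)) by apply Hcounit.
split; [exact hc |].
destruct (pushout_exists (wax E) (to_zero E (T e)) hc) as [w [p [q po]]].
assert (hw : TorsionFree w).
{ apply eta_iso_of_j_zero.
  pose proof (exact_pushout exact_j hc po) as poj.
  apply (is_zero_iso_inv (pushout_of_iso (pushout_sym poj) (j_eps_iso e))).
  apply is_zero_eq, (exact_zero exact_j). }
assert (hp : IsIso (fmap S p)).
{ apply (iso_fmap g), (pushout_of_iso (exact_pushout exact_f hc po)).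
  apply map_of_zeros_iso; apply is_zero_eq.
  - apply (seq_zero (split_exact Hsplit)).
  - apply (exact_zero exact_f). }
destruct hp as [k [k1 k2]].
apply (@pushout_transport _ _ _ _ _ _ _ _ _ _ _ _ _ _ _ _ _
         (id _) (id _) (id _) (k ∘ eta w) po);
  rewrite ?comp_id_l, ?comp_id_r; try easy; try apply iso_id.
- rewrite <- comp_assoc, eta_nat, comp_assoc, k1; apply comp_id_l.
- now apply zero_maps_from.
- apply iso_comp; [now exists (fmap S p) | exact hw].
Qed.

Context (Hcorner : forall (e e' : E) (u : Hom e e'), cof E u ->
    CornerMapCof E (adj_counit ij e) (fmap i (fmap j u)) u (adj_counit ij e'))
  (Hiso : forall (a0 a1 : A) (u : Hom a0 a1) (v : Hom a1 (zero A)),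
    IsCofiberSequence A u v -> IsIso u).

(** * Extensions of torsion-free objects by torsion objects *)

Local Notation Ext := (ExtCat TorsionPart TorsionFreePart).
Local Notation ExtW := (ExtStr TorsionPart TorsionFreePart).

(** The quotient of [j (ext_inc X)] is [j] of a torsion-free object, hence zero,
    and cofibrations of [A] with zero quotient are isomorphisms. *)
Lemma j_inc_iso (X : Ext) : IsIso (fmap j (ext_inc X)).
Proof.
destruct (ext_cofseq X) as [hc hq].
apply Hiso with (v := to_zero A _); split.
{ now apply (exact_cof exact_j). }
assert (hz : IsZero (j (zero E))).
{ apply is_zero_eq, (exact_zero exact_j). }
assert (hb : IsZero (j (proj1_sig (ext_quo X)))).
{ apply j_torsion_free_zero, (proj2_sig (ext_quo X)). }
apply (@pushout_transport _ _ _ _ _ _ _ _ _ _ _ _ _ _ _ _ _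
         (id _) (id _) (to_zero A _) (to_zero A _)
         (exact_pushout exact_j hc hq));
  rewrite ?comp_id_l, ?comp_id_r; try easy; try apply iso_id;
  now apply zero_maps_to.
Qed.

Lemma T_inc_iso (X : Ext) : IsIso (fmap T (ext_inc X)).
Proof. apply (iso_fmap i), j_inc_iso. Qed.

Lemma S_prj_iso (X : Ext) : IsIso (fmap S (ext_prj X)).
Proof.
destruct (ext_cofseq X) as [hc hq].
apply (iso_fmap g), (pushout_of_iso (exact_pushout exact_f hc hq)).
apply map_of_zeros_iso.
- apply f_torsion_zero, (proj2_sig (ext_sub X)).
- apply is_zero_eq, (exact_zero exact_f).
Qed.

(** [T] inverts the inclusion of the subobject, and on torsion objects [T] is
    isomorphic to the identity; so the factorization can be made after applying
    [T] and transported back by naturality. *)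
Lemma inc_coreflection (a : E) (X : Ext) (v : Hom a (ext_mid X)) :
  Torsion a -> exists! h : Hom a (proj1_sig (ext_sub X)), ext_inc X ∘ h = v.
Proof.
intros ha; destruct (T_inc_iso X) as [k [k1 k2]].
destruct ha as [l [l1 l2]].
exists (eps _ ∘ (k ∘ fmap T v) ∘ l); split.
- rewrite !comp_assoc, <- eps_nat; chain k2; rewrite comp_id_r, eps_nat.
  chain l2; apply comp_id_r.
- intros h <-; rewrite fmap_comp, (comp_assoc k), k1, comp_id_l, eps_nat.
  chain l2; apply comp_id_r.
Qed.

Definition middle : Functor Ext E :=
  @Build_Functor Ext E (fun X => ext_mid X) (fun X Y u => hom_mid u)
    (fun X => eq_refl) (fun X Y Z v u => eq_refl).

(** The first component of a lift comes from the coreflection property of the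
    subobject, the last one from the universal property of the quotient. *)
Lemma middle_ff : FullyFaithful middle.
Proof.
intros X Y m; change (Hom (ext_mid X) (ext_mid Y)) in m.
destruct (inc_coreflection (m ∘ ext_inc X) (proj2_sig (ext_sub X)))
  as [s [es su]].
destruct (ext_cofseq X) as [_ po], (ext_cofseq Y) as [_ po'].
destruct (proj2 po _ (ext_prj Y ∘ m) (from_zero E _)) as [q [[eq _] qu]].
{ rewrite <- comp_assoc, <- es, comp_assoc, (proj1 po').
  rewrite <- comp_assoc; f_equal; now apply zero_maps_to. }
exists (@Build_ExtHom _ _ _ X Y (exist (fun _ => True) s I) m
          (exist (fun _ => True) q I) (eq_sym es) eq).
split; [reflexivity |].
intros h <-; apply ExtHom_eq; [| reflexivity |]; apply sig_eq; simpl.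
- apply su; symmetry; apply hom_inc.
- apply qu; split; [apply hom_prj |].
  apply zero_maps_from; reflexivity.
Qed.

Definition decompose_ob (e : E) : Ext :=
  @Build_ExtOb E TorsionPart TorsionFreePart
    (exist Torsion (T e) (eps_i_iso (j e))) e
    (exist TorsionFree (S e) (eta_g_iso (f e)))
    (eps e) (eta e) (eps_eta_cofseq e).

Definition decompose_hom (e e' : E) (u : Hom e e') :
  Hom (decompose_ob e) (decompose_ob e') :=
  @Build_ExtHom E TorsionPart TorsionFreePart (decompose_ob e) (decompose_ob e')
    (exist (fun _ => True) (fmap T u) I) u (exist (fun _ => True) (fmap S u) I)
    (eq_sym (eps_nat u)) (eq_sym (eta_nat u)).

Definition decompose : Functor E Ext.
Proof.
refine (@Build_Functor E Ext decompose_ob decompose_hom _ _);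
  intros; apply (ff_faithful middle_ff); reflexivity.
Defined.

Definition sub_to_E : Functor Ext E :=
  Inclusion _ ∘F std_s TorsionPart TorsionFreePart.
Definition quo_to_E : Functor Ext E :=
  Inclusion _ ∘F std_q TorsionPart TorsionFreePart.

(** The compatibility with the inclusions is what identifies the corner map of an
    extension with that of the counits. *)
Lemma sub_iso_T :
  exists t : NatTrans (T ∘F middle) sub_to_E,
    IsNatIso t /\ forall X : Ext, ext_inc X ∘ t X = eps (ext_mid X).
Proof.
assert (h : forall X : Ext, exists t : Hom (T (ext_mid X)) (proj1_sig (ext_sub X)),
             IsIso t /\ ext_inc X ∘ t = eps (ext_mid X)).
{ intros X; destruct (T_inc_iso X) as [k [k1 k2]].
  exists (eps _ ∘ k); split.
  - apply iso_comp; [apply (proj2_sig (ext_sub X)) |].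
    now exists (fmap T (ext_inc X)).
  - rewrite comp_assoc, <- eps_nat; chain k2; apply comp_id_r. }
pose (t X := constructive_indefinite_description _ (h X)).
unshelve eexists.
{ refine (@Build_NatTrans Ext E (T ∘F middle) sub_to_E
            (fun X => proj1_sig (t X)) _).
  intros X Y u.
  destruct (t X) as [tX [hX eX]], (t Y) as [tY [hY eY]]; simpl proj1_sig.
  (* Both sides are lifts along the inclusion of the same map out of a torsion
     object. *)
  destruct (inc_coreflection (X := Y) (hom_mid u ∘ eps (ext_mid X))
              (eps_i_iso (j (ext_mid X)))) as [m [_ hm]].
  transitivity m; [symmetry |]; apply hm.
  - change (ext_inc Y ∘ (tY ∘ fmap T (hom_mid u)) =
            hom_mid u ∘ eps (ext_mid X)).
    rewrite comp_assoc, eY; apply eps_nat.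
  - change (ext_inc Y ∘ (proj1_sig (hom_sub u) ∘ tX) =
            hom_mid u ∘ eps (ext_mid X)).
    now rewrite <- eX, !comp_assoc, hom_inc. }
split; intros X; simpl; now destruct (t X) as [tX [hX eX]].
Qed.

Lemma quo_iso_S : NatIsomorphic (S ∘F middle) quo_to_E.
Proof.
apply nat_isomorphic_trans with (G := S ∘F quo_to_E).
- unshelve eexists.
  { refine (@Build_NatTrans Ext E (S ∘F middle) (S ∘F quo_to_E)
              (fun X => fmap S (ext_prj X)) _).
    intros X Y u.
    change (fmap S (ext_prj Y) ∘ fmap S (hom_mid u) =
            fmap S (proj1_sig (hom_quo u)) ∘ fmap S (ext_prj X)).
    now rewrite <- !fmap_comp, hom_prj. }
  intros X; apply S_prj_iso.
- apply nat_isomorphic_sym; unshelve eexists.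
  { refine (@Build_NatTrans Ext E quo_to_E (S ∘F quo_to_E)
              (fun X => eta (quo_to_E X)) _).
    intros X Y u; apply eta_nat. }
  intros X; apply (proj2_sig (ext_quo X)).
Qed.

(** If the first component and the corner map are cofibrations, then so is the
    composite of a pushout of the former with the latter, which is the middle
    component. Conversely, the first component is isomorphic to [T] of the
    middle one, and the pushout that defines the corner map is isomorphic to
    the pushout along the counit, where the hypothesis on counits applies. *)
Lemma ext_cof_middle (X Y : Ext) (u : Hom X Y) :
  cof ExtW u <-> cof E (hom_mid u).
Proof.
destruct (ext_cofseq X) as [hX _].
split.
- intros [hs hc].
  destruct (pushout_exists (wax E) (proj1_sig (hom_sub u)) hX)
    as [w [p [q po]]].
  destruct (proj2 po _ (hom_mid u) (ext_inc Y) (hom_inc u)) as [h [[h1 h2] _]].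
  rewrite <- h1; apply (cof_comp (wax E)).
  + apply (hc w p q h po h1 h2).
  + exact (cof_pushout (wax E) hs (pushout_sym po)).
- intros hm; destruct sub_iso_T as [t [ht et]].
  pose proof (naturality t u) as nt.
  split.
  + apply (cof_conj nt (ht X) (ht Y)).
    now apply (exact_cof exact_T).
  + intros w p q h po h1 h2.
    destruct (ht X) as [k [k1 k2]], (ht Y) as [l [l1 l2]].
    apply (Hcorner hm (w := w) (p := p) (q := q ∘ t Y)).
    * apply (@pushout_transport _ _ _ _ _ _ _ _ _ _ _ _ _ _ _ _ _
               k (id _) l (id _) po);
        rewrite ?comp_id_l, ?comp_id_r; try apply iso_id; try easy.
      -- change (ext_inc X = eps (ext_mid X) ∘ k).
         rewrite <- et; chain k2; now rewrite comp_id_r.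
      -- apply (iso_epi (ht X)); rewrite <- comp_assoc.
         change (l ∘ (fmap sub_to_E u ∘ t X) =
                 fmap (T ∘F middle) u ∘ k ∘ t X).
         rewrite <- nt, comp_assoc, l1, comp_id_l; chain k1.
         now rewrite comp_id_r.
      -- chain l2; now rewrite comp_id_r.
      -- now exists (t X).
      -- now exists (t Y).
    * exact h1.
    * rewrite comp_assoc, h2; apply et.
Qed.

Lemma ext_weq_middle (X Y : Ext) (u : Hom X Y) :
  weq ExtW u <-> weq E (hom_mid u).
Proof.
split; [now intros [_ [h _]] |]; intros h.
destruct sub_iso_T as [t [ht _]], quo_iso_S as [r hr].
split; [| split; [exact h |]].
- apply (weq_conj (naturality t u) (ht X) (ht Y)).
  now apply (exact_weq exact_T).
- apply (weq_conj (naturality r u) (hr X) (hr Y)).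
  now apply (exact_weq exact_S).
Qed.

Lemma middle_embedding : Embedding ExtW E middle.
Proof.
constructor.
- apply middle_ff.
- reflexivity.
- apply ext_cof_middle.
- apply ext_weq_middle.
Qed.

(** The pushout in [E] is lifted by its own decomposition, because [decompose] is
    a strict section of [middle]. *)
Lemma middle_lift (X Y Z : Ext) (u : Hom X Y) (v : Hom X Z) : cof ExtW u ->
  exists (W : Ext) (p : Hom Y W) (q : Hom Z W),
    IsPushout (fmap middle u) (fmap middle v) (fmap middle p) (fmap middle q).
Proof.
intros hu; apply ext_cof_middle in hu.
destruct (pushout_exists (wax E) (hom_mid v) hu) as [w [p [q po]]].
destruct (ff_full middle_ff (x := Y) (y := decompose w) p) as [p' ep].
destruct (ff_full middle_ff (x := Z) (y := decompose w) q) as [q' eq].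
exists (decompose w), p', q'; rewrite ep, eq; exact po.
Qed.

Lemma ext_waldhausen : IsWaldhausen ExtW.
Proof. exact (embedding_waldhausen middle_embedding middle_lift). Qed.

Lemma middle_exact : IsExact ExtW E middle.
Proof. exact (embedding_exact middle_embedding middle_lift). Qed.

Local Notation EW := (ExtWald ext_waldhausen).
Local Notation torsion_embedding := (full_embedding torsion_zero).
Local Notation torsion_free_embedding := (full_embedding torsion_free_zero).

(** * The standard sequence is split exact *)

(* The two functors agree on objects and maps up to conversion, though not as
   records, since they carry different proofs. *)
Ltac identity_iso :=
  unshelve eexists;
  [ unshelve econstructor;
    [ intros x; exact (id _)
    | intros x y u; simpl; rewrite comp_id_l, comp_id_r; reflexivity ]
  | intros x; apply iso_id ].

(** Exact functors must hit the distinguished zero object on the nose. Between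
    zero objects there is only one map, so an extension is equal to the zero one
    once its three objects are. *)
Lemma ext_eq_zero (X : Ext) :
  ext_sub X = zero TorsionPart -> ext_mid X = zero E ->
  ext_quo X = zero TorsionFreePart -> X = zero ExtW.
Proof.
destruct X as [a c b u v hc]; simpl ext_sub; simpl ext_mid; simpl ext_quo.
intros ea ec eb; revert u v hc; rewrite ea, ec, eb; intros u v hc.
assert (eu : u = to_zero E _) by now apply zero_maps_to.
assert (ev : v = from_zero E _) by now apply zero_maps_from.
revert hc; rewrite eu, ev; intros hc.
simpl; unfold ext_zero; f_equal; apply proof_irrelevance.
Qed.

(** Each of the standard functors becomes a known exact functor after an
    embedding: [std_i] and [std_g] become the inclusions of the torsion and
    torsion-free objects, [std_s] and [std_q] become [T] and [S] of the middle
    term. *)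
Lemma std_i_exact :
  IsExact TorsionPart EW (std_i TorsionPart TorsionFreePart).
Proof.
apply exact_of_preserves; [now apply ext_eq_zero |].
apply (embedding_reflects_preserves middle_embedding).
apply (@preserves_nat_isomorphic _ _ E (Inclusion (sub_cat TorsionPart))).
- identity_iso.
- apply exact_preserves, (inclusion_exact torsion_zero torsion_pushout).
Qed.

Lemma std_g_exact :
  IsExact TorsionFreePart EW (std_g TorsionPart TorsionFreePart).
Proof.
apply exact_of_preserves; [now apply ext_eq_zero |].
apply (embedding_reflects_preserves middle_embedding).
apply (@preserves_nat_isomorphic _ _ E (Inclusion (sub_cat TorsionFreePart))).
- identity_iso.
- apply exact_preserves,
    (inclusion_exact torsion_free_zero torsion_free_pushout).
Qed.

Lemma std_s_exact :
  IsExact EW TorsionPart (std_s TorsionPart TorsionFreePart).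
Proof.
apply exact_of_preserves; [reflexivity |].
apply (embedding_reflects_preserves torsion_embedding).
apply (@preserves_nat_isomorphic _ _ E (T ∘F middle)).
- destruct sub_iso_T as [t [ht _]]; now exists t.
- apply exact_preserves; exact (exact_comp exact_T middle_exact).
Qed.

Lemma std_q_exact :
  IsExact EW TorsionFreePart (std_q TorsionPart TorsionFreePart).
Proof.
apply exact_of_preserves; [reflexivity |].
apply (embedding_reflects_preserves torsion_free_embedding).
apply (@preserves_nat_isomorphic _ _ E (S ∘F middle)).
- exact quo_iso_S.
- apply exact_preserves; exact (exact_comp exact_S middle_exact).
Qed.

Lemma std_i_ff : FullyFaithful (std_i TorsionPart TorsionFreePart).
Proof.
apply (ff_of_comp middle_ff); exact (inclusion_ff (P := Torsion)).
Qed.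

Definition std_counit_at (X : Ext) :
  Hom (std_i TorsionPart TorsionFreePart (ext_sub X)) X.
Proof.
refine (@Build_ExtHom _ _ _ (std_i_ob _ (ext_sub X)) X
          (id (ext_sub X)) (ext_inc X) (from_zero TorsionFreePart _) _ _).
- reflexivity.
- etransitivity; [| symmetry; exact (proj1 (proj2 (ext_cofseq X)))].
  simpl; f_equal; now apply zero_maps_to.
Defined.

Definition std_unit_at (X : Ext) :
  Hom X (std_g TorsionPart TorsionFreePart (ext_quo X)).
Proof.
refine (@Build_ExtHom _ _ _ X (std_g_ob _ (ext_quo X))
          (to_zero TorsionPart _) (ext_prj X) (id (ext_quo X)) _ _).
- etransitivity; [exact (proj1 (proj2 (ext_cofseq X))) |].
  simpl; unfold zero_map; rewrite <- comp_assoc; f_equal.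
  now apply zero_maps_to.
- reflexivity.
Defined.

Definition std_adj_is :
  Adjunction (std_i TorsionPart TorsionFreePart)
             (std_s TorsionPart TorsionFreePart).
Proof.
unshelve refine {| adj_unit := _; adj_counit := _ |}.
- refine (@Build_NatTrans _ _ (IdFunctor (SubCat (sub_cat TorsionPart)))
            (std_s TorsionPart TorsionFreePart
               ∘F std_i TorsionPart TorsionFreePart)
            (fun a => id a) _).
  intros x y u; simpl; apply sig_eq; simpl.
  now rewrite comp_id_l, comp_id_r.
- refine (@Build_NatTrans _ _ (std_i TorsionPart TorsionFreePart
               ∘F std_s TorsionPart TorsionFreePart) (IdFunctor Ext)
            std_counit_at _).
  intros X Y u; apply (ff_faithful middle_ff); simpl.
  exact (eq_sym (hom_inc u)).
- intros a; apply (ff_faithful middle_ff); simpl; apply comp_id_l.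
- intros X; apply sig_eq; simpl; apply comp_id_l.
Defined.

Definition std_adj_qg :
  Adjunction (std_q TorsionPart TorsionFreePart)
             (std_g TorsionPart TorsionFreePart).
Proof.
unshelve refine {| adj_unit := _; adj_counit := _ |}.
- refine (@Build_NatTrans _ _ (IdFunctor Ext)
            (std_g TorsionPart TorsionFreePart
               ∘F std_q TorsionPart TorsionFreePart) std_unit_at _).
  intros X Y u; apply (ff_faithful middle_ff); simpl.
  exact (eq_sym (hom_prj u)).
- refine (@Build_NatTrans _ _ (std_q TorsionPart TorsionFreePart
               ∘F std_g TorsionPart TorsionFreePart)
            (IdFunctor (SubCat (sub_cat TorsionFreePart)))
            (fun b => id b) _).
  intros x y u; simpl; apply sig_eq; simpl.
  now rewrite comp_id_l, comp_id_r.
- intros X; apply sig_eq; simpl; apply comp_id_l.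
- intros b; apply (ff_faithful middle_ff); simpl; apply comp_id_l.
Defined.

(** The subobject of [std_g b] is zero, and a map out of [std_i a] factors through
    it already on middle terms. *)
Lemma std_g_orthogonal (b : TorsionFreePart) :
  in_ob (RightOrthogonal (std_i TorsionPart TorsionFreePart))
    (std_g TorsionPart TorsionFreePart b).
Proof.
intros a; exists (from_zero ExtW _ ∘ to_zero ExtW _); intros v.
apply (ff_faithful middle_ff).
assert (e : hom_mid v = ext_inc (std_g_ob TorsionPart b) ∘ proj1_sig (hom_sub v)).
{ rewrite <- hom_inc; simpl; now rewrite comp_id_r. }
simpl in *; rewrite e; unfold zero_map.
rewrite <- comp_assoc; f_equal; now apply zero_maps_to.
Qed.

(** Orthogonality forces the subobject to be zero, and then the projection to the
    quotient is invertible. *)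
Lemma std_unit_iso_of_orthogonal (X : Ext) :
  in_ob (RightOrthogonal (std_i TorsionPart TorsionFreePart)) X ->
  IsIso (std_unit_at X).
Proof.
intros hX; apply (ff_reflects_iso middle_ff); simpl.
destruct (ext_cofseq X) as [_ po].
apply (pushout_of_iso po).
(* The counit is a map from an object in the image of [std_i] to [X], so it
   agrees with the zero map. Its first component is the identity of the
   subobject, which is therefore zero. *)
destruct (hX (ext_sub X)) as [m hm].
assert (e : std_counit_at X = from_zero ExtW X ∘ to_zero ExtW _)
  by now rewrite (hm (std_counit_at X)), hm.
apply (f_equal (fun h => proj1_sig (hom_sub h))) in e; simpl in e.
apply (@is_zero_of_factor E _ (zero E) _ _ (is_zero_eq eq_refl) (eq_sym e)).
Qed.

Definition std_g_into_orthogonal :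
  Functor (SubCat (sub_cat TorsionFreePart))
    (SubCat (RightOrthogonal (std_i TorsionPart TorsionFreePart))).
Proof.
unshelve refine (@Build_Functor (SubCat (sub_cat TorsionFreePart))
  (SubCat (RightOrthogonal (std_i TorsionPart TorsionFreePart)))
  (fun b => exist _ _ (std_g_orthogonal b))
  (fun b b' u => exist (fun _ => True) (std_g_hom TorsionPart u) I) _ _);
  intros; apply sig_eq, (ff_faithful middle_ff); reflexivity.
Defined.

Lemma std_equivalence :
  IsEquivalence (std_q TorsionPart TorsionFreePart ∘F
    Inclusion (RightOrthogonal (std_i TorsionPart TorsionFreePart))).
Proof.
exists std_g_into_orthogonal.
split.
- apply nat_isomorphic_sym; unshelve eexists.
  { unshelve econstructor.
    - intros [X hX]; exact (exist (fun _ => True) (std_unit_at X) I).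
    - intros [X hX] [Y hY] [u []]; apply sig_eq; simpl.
      apply (naturality (adj_unit std_adj_qg) u). }
  intros [X hX]; apply (ff_reflects_iso (inclusion_ff (P := _))); simpl.
  now apply std_unit_iso_of_orthogonal.
- unshelve eexists.
  { unshelve econstructor.
    - intros b; exact (id b).
    - intros b b' u; apply sig_eq; simpl; now rewrite comp_id_l, comp_id_r. }
  intros b; apply iso_id.
Qed.

Lemma std_split :
  @IsSplitExactSequence TorsionPart EW TorsionFreePart
    (std_i TorsionPart TorsionFreePart) (std_q TorsionPart TorsionFreePart)
    (std_s TorsionPart TorsionFreePart) (std_g TorsionPart TorsionFreePart)
    std_adj_is std_adj_qg.
Proof.
constructor.
- constructor.
  + exact std_i_exact.
  + exact std_q_exact.
  + reflexivity.
  + exact std_i_ff.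
  + exact std_equivalence.
- exact std_s_exact.
- exact std_g_exact.
- intros a; apply iso_id.
- intros b; apply iso_id.
Qed.

(** * The equivalence with the standard sequence *)

Definition to_torsion : Functor A (SubCat (sub_cat TorsionPart)).
Proof.
unshelve refine (@Build_Functor A (SubCat (sub_cat TorsionPart))
  (fun a => exist Torsion (i a) (eps_i_iso a))
  (fun a a' u => exist (fun _ => True) (fmap i u) I) _ _);
  intros; apply sig_eq; simpl; [apply fmap_id | apply fmap_comp].
Defined.

Definition to_torsion_free : Functor B (SubCat (sub_cat TorsionFreePart)).
Proof.
unshelve refine (@Build_Functor B (SubCat (sub_cat TorsionFreePart))
  (fun b => exist TorsionFree (g b) (eta_g_iso b))
  (fun b b' u => exist (fun _ => True) (fmap g u) I) _ _);
  intros; apply sig_eq; simpl; [apply fmap_id | apply fmap_comp].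
Defined.

Lemma to_torsion_equivalence : @IsWaldEquivalence A TorsionPart to_torsion.
Proof.
split; [| exists (j ∘F Inclusion (sub_cat TorsionPart)); split; [| split]].
- apply exact_of_preserves; [apply sig_eq, (exact_zero exact_i) |].
  apply (embedding_reflects_preserves torsion_embedding).
  apply (@preserves_nat_isomorphic _ _ E i); [identity_iso |].
  apply exact_preserves, exact_i.
- exact (exact_comp exact_j (inclusion_exact torsion_zero torsion_pushout)).
- apply nat_isomorphic_sym; unshelve eexists.
  { unshelve econstructor.
    - intros a; exact (adj_unit ij a).
    - intros a a' u; apply (naturality (adj_unit ij) u). }
  intros a; apply (split_unit Hsplit).
- unshelve eexists.
  { unshelve econstructor.
    - intros e; exact (exist (fun _ => True) (eps (proj1_sig e)) I).
    - intros e e' u; apply sig_eq; apply (eps_nat (proj1_sig u)). }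
  intros e; apply (ff_reflects_iso (inclusion_ff (P := Torsion))).
  apply (proj2_sig e).
Qed.

Lemma to_torsion_free_equivalence :
  @IsWaldEquivalence B TorsionFreePart to_torsion_free.
Proof.
split; [| exists (f ∘F Inclusion (sub_cat TorsionFreePart)); split; [| split]].
- apply exact_of_preserves; [apply sig_eq, (exact_zero exact_g) |].
  apply (embedding_reflects_preserves torsion_free_embedding).
  apply (@preserves_nat_isomorphic _ _ E g); [identity_iso |].
  apply exact_preserves, exact_g.
- exact (exact_comp exact_f
           (inclusion_exact torsion_free_zero torsion_free_pushout)).
- unshelve eexists.
  { unshelve econstructor.
    - intros b; exact (adj_counit fg b).
    - intros b b' u; apply (naturality (adj_counit fg) u). }
  intros b; apply (split_counit Hsplit).
- apply nat_isomorphic_sym; unshelve eexists.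
  { unshelve econstructor.
    - intros e; exact (exist (fun _ => True) (eta (proj1_sig e)) I).
    - intros e e' u; apply sig_eq; apply (eta_nat (proj1_sig u)). }
  intros e; apply (ff_reflects_iso (inclusion_ff (P := TorsionFree))).
  apply (proj2_sig e).
Qed.

Lemma decompose_equivalence : @IsWaldEquivalence E EW decompose.
Proof.
split; [| exists middle; split; [| split]].
- apply exact_of_preserves.
  + apply ext_eq_zero; [apply sig_eq | reflexivity | apply sig_eq].
    * apply (exact_zero exact_T).
    * apply (exact_zero exact_S).
  + apply (embedding_reflects_preserves middle_embedding).
    apply (@preserves_nat_isomorphic _ _ E (IdFunctor E)); [identity_iso |].
    now constructor.
- exact middle_exact.
- identity_iso.
- apply (ff_reflects_nat_isomorphic middle_ff); identity_iso.
Qed.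

Lemma standard_equivalence :
  @SequencesWaldEquivalent A E B i f TorsionPart EW TorsionFreePart
    (std_i TorsionPart TorsionFreePart) (std_q TorsionPart TorsionFreePart).
Proof.
exists to_torsion, decompose, to_torsion_free.
split; [exact to_torsion_equivalence |].
split; [exact decompose_equivalence |].
split; [exact to_torsion_free_equivalence |].
split.
- apply (ff_reflects_nat_isomorphic middle_ff); identity_iso.
- apply (ff_reflects_nat_isomorphic (inclusion_ff (P := TorsionFree))).
  identity_iso.
Qed.

End SplitSequence.

Theorem proposition2p12
  (A E B : Waldhausen)
  (i : Functor A E) (f : Functor E B) (j : Functor E A) (g : Functor B E)
  (ij : Adjunction i j) (fg : Adjunction f g)
  (Hsplit : IsSplitExactSequence ij fg)
  (Hcounit : forall e : E, cof E (adj_counit ij e))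
  (Hcorner : forall (e e' : E) (u : Hom e e'), cof E u ->
    CornerMapCof E (adj_counit ij e) (fmap i (fmap j u)) u (adj_counit ij e'))
  (Hiso : forall (a0 a1 : A) (u : Hom a0 a1) (v : Hom a1 (zero A)),
    IsCofiberSequence A u v -> IsIso u) :
  exists (C : Waldhausen) (A' B' : SubWaldhausen C)
         (HE : IsWaldhausen (ExtStr A' B'))
         (is' : @Adjunction A' (ExtWald HE) (std_i A' B') (std_s A' B'))
         (qg' : @Adjunction (ExtWald HE) B' (std_q A' B') (std_g A' B')),
    @IsSplitExactSequence A' (ExtWald HE) B'
      (std_i A' B') (std_q A' B') (std_s A' B') (std_g A' B') is' qg' /\
    @SequencesWaldEquivalent A E B i f
      A' (ExtWald HE) B' (std_i A' B') (std_q A' B').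
Proof.
exists E, (TorsionPart Hsplit), (TorsionFreePart Hsplit),
  (ext_waldhausen Hsplit Hcounit Hcorner Hiso),
  (std_adj_is Hsplit Hiso), (std_adj_qg Hsplit Hiso).
split.
- apply std_split.
- apply standard_equivalence.
Qed.
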